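(* Let $\Gamma$ be a finite group with unit element $e$, let $X \subseteq \Gamma$ be a connection set, and let $G = \operatorname{Cay}(\Gamma, X)$. Then \[ \vartheta(G) = \max \Big\{ \sum_{\gamma \in \Gamma} f(\gamma) \;:\; f \in \mathcal{P}(\Gamma) \text{ real-valued},\ f(e) = 1,\ f(x) = 0 \text{ for all } x \in X \Big\}. \]
   Context: A subset $X$ of a finite group $\Gamma$ with unit element $e$ is a connection set if $e \notin X$ and $x^{-1} \in X$ whenever $x \in X$. (It is not required that $X$ generates $\Gamma$.) The Cayley graph $\operatorname{Cay}(\Gamma, X)$ is the simple undirected graph with vertex set $\Gamma$ in which vertices $x$ and $y$ are adjacent if and only if $y^{-1}x \in X$. For a finite simple undirected graph $G = (V,E)$, the Lovász $\vartheta$-number is \[ \vartheta(G) = \max \Big\{ \sum_{u,v \in V} A(u,v) \;:\; A \in \mathcal{S}^V_{\succeq 0} \text{ real-valued},\ \operatorname{Tr}(A) = 1,\ A(u,v) = 0 \text{ for } \{u,v\} \in E \Big\}, \] where $\mathcal{S}^V_{\succeq 0}$ is the set of (complex, Hermitian) positive semidefinite matrices with rows and columns indexed by $V$; so the real-valued ones are the real symmetric positive semidefinite matrices. For $f, g \colon \Gamma \to \mathbb{C}$, the convolution is $f * g(\gamma) = \sum_{\beta \in \Gamma} f(\beta) g(\beta^{-1}\gamma)$ and the involution is $f^*(\gamma) = \overline{f(\gamma^{-1})}$. A function $f \colon \Gamma \to \mathbb{C}$ is of positive type if $\sum_{\gamma \in \Gamma} g * g^*(\gamma) f(\gamma)$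 is a nonnegative real number for every function $g \colon \Gamma \to \mathbb{C}$. The set of functions on $\Gamma$ of positive type is denoted $\mathcal{P}(\Gamma)$. *)

(* Defs.v *)
From HB Require Import structures.
From mathcomp Require Import all_boot all_order all_fingroup all_algebra.
From mathcomp Require Import sesquilinear spectral complex.
From mathcomp Require Import boolp classical_sets reals.

Set Implicit Arguments.
Unset Strict Implicit.
Unset Printing Implicit Defensive.

Import Order.TTheory GRing.Theory Num.Theory.
Local Open Scope classical_set_scope.
Local Open Scope ring_scope.
Local Open Scope complex_scope.
Local Open Scope sesquilinear_scope.

Record sgraph (V : finType) := SGraph {
  adj : rel V;
  adj_sym : symmetric adj;
  adj_irr : irreflexive adj }.

Section Cayley.
Variable gT : finGroupType.
Local Open Scope group_scope.

Definition connection_set (X : {set gT}) : Prop :=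
  1 \notin X /\ forall x, x \in X -> x^-1 \in X.

Definition cayley_adj (X : {set gT}) : rel gT := fun x y => y^-1 * x \in X.

Lemma cayley_adj_sym (X : {set gT}) :
  connection_set X -> symmetric (cayley_adj X).
Proof.
move=> [_ XV] x y; rewrite /cayley_adj.
by apply/idP/idP => /XV; rewrite invMg invgK.
Qed.

Lemma cayley_adj_irr (X : {set gT}) :
  connection_set X -> irreflexive (cayley_adj X).
Proof. by move=> [X1 _] x; rewrite /cayley_adj mulVg; apply: negbTE. Qed.

Definition Cay (X : {set gT}) (hX : connection_set X) : sgraph gT :=
  SGraph (cayley_adj_sym hX) (cayley_adj_irr hX).

End Cayley.

Section PositiveType.
Variables (C : numClosedFieldType) (gT : finGroupType).
Implicit Types f g : gT -> C.

Definition conv f g : gT -> C :=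
  fun c => \sum_(b : gT) f b * g (b^-1 * c)%g.

Definition invol f : gT -> C := fun c => (f c^-1%g)^*%R.

(* In a numClosedFieldType, [0 <= z] already says that [z] is real. *)
Definition positive_type f : Prop :=
  forall g, 0 <= \sum_(c : gT) conv g (invol g) c * f c.

End PositiveType.

Definition psdmx (C : numClosedFieldType) (n : nat) (A : 'M[C]_n) : Prop :=
  A \is hermsymmx /\ forall u : 'rV[C]_n, 0 <= (u *m A *m u ^t* ) 0 0.

Section Maximum.
Variable R : realType.

Definition is_maximum (S : set R) (t : R) : Prop := S t /\ ubound S t.

(* The default value 0 is used only when [S] has no maximum. *)
Definition maximum (S : set R) : R := xget 0 (is_maximum S).

End Maximum.

Section Theta.
Variable R : realType.

(* Rows and columns are indexed by [V] through [enum_rank : V -> 'I_#|V|]. *)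
Definition theta_feasible (V : finType) (G : sgraph V)
    (A : 'M[R[i]]_#|V|) : Prop :=
  [/\ psdmx A,
      A \is a realmx,
      \tr A = 1 &
      forall u v : V, adj G u v -> A (enum_rank u) (enum_rank v) = 0].

Definition theta_values (V : finType) (G : sgraph V) : set R :=
  [set t | exists2 A : 'M[R[i]]_#|V|, theta_feasible G A
           & t%:C = \sum_(u : V) \sum_(v : V) A (enum_rank u) (enum_rank v)].

Definition lovasz_theta (V : finType) (G : sgraph V) : R :=
  maximum (theta_values G).

Definition positive_type_values (gT : finGroupType) (X : {set gT}) : set R :=
  [set t | exists2 f : gT -> R[i],
             [/\ positive_type f,
                 forall c, f c \is Num.real,
                 f 1%g = 1 &
                 forall x, x \in X -> f x = 0]
           & t%:C = \sum_(c : gT) f c].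

End Theta.

Arguments theta_values R {V} G.
Arguments lovasz_theta R {V} G.
Arguments positive_type_values R {gT} X.

(* Main.v *)
Require Import Defs.
From mathcomp Require Import all_boot all_order all_fingroup all_algebra.
From mathcomp Require Import boolp classical_sets reals.
From mathcomp Require Import complex ring lra.
From mathcomp Require Import topology normedtype derive.

(** Write a matrix indexed by the group as a kernel [K x y].  A function [f] is
    of positive type exactly when the kernel [f (y^-1 * x)], which is invariant
    under left translations, is positive semidefinite ([positive_typeP]).
    Left translations are automorphisms of the Cayley graph, so averaging a
    feasible matrix [A] over them yields an invariant feasible kernel with the
    same entry sum; up to the factor [#|gT|] this kernel is given by the
    function [f c = \sum_b A (b * c) b].  Conversely [f] gives back the matrix
    [A x y = f (y^-1 * x) / #|gT|].  The constraints correspond ([f 1] to the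
    trace, the zeros on [X] to the zeros on edges), and so do the objectives:
    hence the two problems have the same set of values, by
    [theta_values_sub_positive_type] and [positive_type_values_sub_theta].

    It remains to see that this set has a largest element.  This is done on the
    side of functions: real functions of positive type with [f 1 = 1] take
    values between -1 and 1, and all constraints are closed conditions, namely
    linear equations and inequalities in the values of [f], one pair of them
    for each test function [g] of the positivity condition.  The feasible
    functions thus form a compact set ([compact_feasible]), which contains the
    indicator function of the unit, and the continuous objective attains its
    maximum on it. *)

Set Implicit Arguments.
Unset Strict Implicit.
Unset Printing Implicit Defensive.

Import Order.TTheory GRing.Theory Num.Theory.
Import numFieldNormedType.Exports.
Local Open Scope classical_set_scope.
Local Open Scope ring_scope.
Local Open Scope complex_scope.
Local Open Scope sesquilinear_scope.

(** * Positive semidefinite kernels *)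

Section Kernels.
Variable C : numClosedFieldType.

Definition psd_kernel (V : finType) (K : V -> V -> C) : Prop :=
  forall h : V -> C, 0 <= \sum_x \sum_y h x * (h y)^*%R * K x y.

(** The form at the test function [s] at [x] plus [t] at [y], the two terms
    being added when [x = y].  All pointwise properties of positive semidefinite
    kernels come from suitable choices of [s] and [t]. *)
Lemma psd_kernel_pair (V : finType) (K : V -> V -> C) (x y : V) (s t : C) :
  psd_kernel K ->
  0 <= s * s^*%R * K x x + s * t^*%R * K x y
       + (t * s^*%R * K y x + t * t^*%R * K y y).
Proof.
move=> Kpsd.
pose h z := s *+ (z == x) + t *+ (z == y).
have pick (F : V -> C) : \sum_z h z * F z = s * F x + t * F y.
  under eq_bigr do rewrite mulrDl.
  rewrite big_split /=; congr (_ + _).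
    rewrite (bigD1 x) //= eqxx big1 ?addr0 // => z /negbTE ->.
    by rewrite mul0r.
  rewrite (bigD1 y) //= eqxx big1 ?addr0 // => z /negbTE ->.
  by rewrite mul0r.
have pickC (F : V -> C) :
    \sum_z (h z)^*%R * F z = s^*%R * F x + t^*%R * F y.
  rewrite -[LHS]conjCK rmorph_sum /=.
  under eq_bigr do rewrite rmorphM /= conjCK.
  by rewrite pick rmorphD !rmorphM /= !conjCK.
have := Kpsd h.
under eq_bigr => z _.
  under eq_bigr do rewrite -mulrA.
  rewrite -mulr_sumr pickC.
  over.
by rewrite pick !mulrDr !mulrA.
Qed.

Lemma psd_kernel_diag (V : finType) (K : V -> V -> C) (x : V) :
  psd_kernel K -> 0 <= K x x.
Proof.
move=> /(psd_kernel_pair x x 1 0).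
by rewrite !conjC0 conjC1 !(mul0r, mulr0, mul1r, addr0).
Qed.

(** Polarization: the cross terms [s t^* K x y + t s^* K y x] of the form are
    real for all [s] and [t], and the choices [t = 1] and [t = 'i] with [s = 1]
    suffice to identify [K x y] with the conjugate of [K y x]. *)
Lemma psd_kernel_herm (V : finType) (K : V -> V -> C) (x y : V) :
  psd_kernel K -> K x y = (K y x)^*%R.
Proof.
move=> Kpsd; have [xx yy] := (psd_kernel_diag x Kpsd, psd_kernel_diag y Kpsd).
have real_off s t : s * t^*%R * K x y + t * s^*%R * K y x \is Num.real.
  have /ger0_real := psd_kernel_pair x y s t Kpsd.
  have -> : forall a b c d : C, a + b + (c + d) = (b + c) + (a + d).
    by move=> a b c d; ring.
  by rewrite rpredDr // rpredD // ger0_real // mulr_ge0 // mul_conjC_ge0.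
have /CrealP := real_off 1 1; have /CrealP := real_off 1 'i%R.
rewrite !(rmorphD, rmorphM, rmorph1) /= !conjCK !conjCi !(mul1r, mulr1).
move=> off_i off_1; apply: (can_inj conjCK); rewrite conjCK.
have two_neq0 : 2 != 0 :> C by rewrite pnatr_eq0.
have off_i' : (K x y)^*%R - (K y x)^*%R = K y x - K x y.
  apply: (mulfI (neq0Ci C)); rewrite mulrBr [in RHS]mulrBr.
  by rewrite -[in LHS]mulNr off_i mulNr addrC.
(* [off_1] and [off_i'] give the sum and the difference of the two conjugates. *)
apply: (mulfI two_neq0).
transitivity ((K x y)^*%R + (K y x)^*%R + ((K x y)^*%R - (K y x)^*%R)).
  by ring.
by rewrite off_1 off_i'; ring.
Qed.

(** The form at the test functions [1] at [x] and [1] or [-1] at [y]. *)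
Lemma psd_kernel_bound (V : finType) (K : V -> V -> C) (x y : V) :
  psd_kernel K -> K x y \is Num.real ->
  - (K x x + K y y) <= K x y *+ 2 <= K x x + K y y.
Proof.
move=> Kpsd Kxy.
have Kyx : K y x = K x y by rewrite (psd_kernel_herm y x Kpsd) (CrealP Kxy).
have := psd_kernel_pair x y 1 1 Kpsd; have := psd_kernel_pair x y 1 (-1) Kpsd.
rewrite Kyx rmorphN /= conjC1 !(mul1r, mulr1, mulrN, mulNr, opprK).
move=> minus plus; apply/andP; split; rewrite -subr_ge0.
  by move: plus; congr (0 <= _); ring.
by move: minus; congr (0 <= _); ring.
Qed.

End Kernels.

(** Hermitian symmetry is automatic over the complex numbers, so only the
    nonnegativity of the form has to be transported along [enum_rank]. *)
Lemma psdmxP (C : numClosedFieldType) (V : finType) (A : 'M[C]_#|V|) :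
  psdmx A <-> psd_kernel (fun x y : V => A (enum_rank x) (enum_rank y)).
Proof.
have formE (u : 'rV[C]_#|V|) : (u *m A *m u ^t* ) 0 0 =
    \sum_x \sum_y u 0 (enum_rank x) * (u 0 (enum_rank y))^*%R
                    * A (enum_rank x) (enum_rank y).
  rewrite mxE exchange_big /= (reindex _ (onW_bij _ (@enum_rank_bij V))) /=.
  apply: eq_bigr => y _; rewrite !mxE mulr_suml.
  rewrite (reindex _ (onW_bij _ (@enum_rank_bij V))) /=.
  by apply: eq_bigr => x _; rewrite mulrAC.
split=> [[_ Apsd] h|Apsd].
  have := Apsd (\row_i h (enum_val i)); rewrite formE.
  under eq_bigr do under eq_bigr do rewrite !mxE !enum_rankK.
  by [].
split=> [|u]; last by rewrite formE.
apply/is_hermitianmxP; rewrite expr0 scale1r; apply/matrixP => i j.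
rewrite !mxE -(enum_valK i) -(enum_valK j).
exact: (psd_kernel_herm (enum_val i) (enum_val j) Apsd).
Qed.

(** * Functions of positive type as invariant kernels *)

Section PositiveTypeKernel.
Variables (C : numClosedFieldType) (gT : finGroupType).
Implicit Types f g : gT -> C.

Lemma sum_conv_involE f g :
  \sum_c conv g (invol g) c * f c =
  \sum_a \sum_b g a * (g b)^*%R * f (a * b^-1)%g.
Proof.
rewrite /conv; under eq_bigr do rewrite mulr_suml.
rewrite exchange_big /=; apply: eq_bigr => a _.
have b_bij : bijective (fun b => a * b^-1)%g.
  exists (fun c => c^-1 * a)%g => b; first by rewrite invMg invgK mulgKV.
  by rewrite invMg invgK mulKVg.
rewrite (reindex _ (onW_bij _ b_bij)) /=.
by apply: eq_bigr => b _; rewrite /invol mulKg invgK.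
Qed.

(** By [sum_conv_involE] positive type concerns the kernel [f (a * b^-1)],
    invariant under right translations.  Inversion turns it into the kernel
    [f (y^-1 * x)] with [x] and [y] exchanged; the conjugation in [flip] makes
    up for that exchange. *)
Lemma positive_typeP f :
  positive_type f <-> psd_kernel (fun x y : gT => f (y^-1 * x)%g).
Proof.
pose flip g x := (g x^-1%g)^*%R.
have flipE g : \sum_x \sum_y flip g x * (flip g y)^*%R * f (y^-1 * x)%g =
    \sum_a \sum_b g a * (g b)^*%R * f (a * b^-1)%g.
  rewrite exchange_big /= (reindex_inj invg_inj) /=.
  apply: eq_bigr => a _; rewrite (reindex_inj invg_inj) /=.
  by apply: eq_bigr => b _; rewrite /flip !invgK conjCK [_^* * _]mulrC.
split=> [fpos h|fpsd g]; last by rewrite sum_conv_involE -flipE.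
have := fpos (flip h); rewrite sum_conv_involE -flipE.
under eq_bigr do under eq_bigr do rewrite /flip !invgK !conjCK.
by [].
Qed.

End PositiveTypeKernel.

(** * Equality of the two sets of values *)

Section Averaging.
Variables (R : realType) (gT : finGroupType) (X : {set gT}).
Variable hX : connection_set X.

(** Averaging over left translations: the kernel of [f] is the sum of the
    translates [K (b * x) (b * y)], each of which is positive semidefinite and
    vanishes on the edges. *)
Lemma theta_values_sub_positive_type :
  theta_values R (Cay hX) `<=` positive_type_values R X.
Proof.
move=> t [A [/psdmxP Apsd Areal Atr Aadj] tE].
pose K x y := A (enum_rank x) (enum_rank y).
pose f c := \sum_b K (b * c)%g b.
exists f; [split|].
- apply/positive_typeP => h.
  have -> : \sum_x \sum_y h x * (h y)^*%R * f (y^-1 * x)%g =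
      \sum_b \sum_x \sum_y h (b^-1 * x)%g * (h (b^-1 * y)%g)^*%R * K x y.
    under [RHS]eq_bigr => b _.
      rewrite (reindex_inj (mulgI b)) /=.
      under eq_bigr => x _.
        rewrite (reindex_inj (mulgI b)) /=.
        under eq_bigr do rewrite !mulKg.
        over.
      over.
    rewrite [RHS]exchange_big /=; apply: eq_bigr => x _.
    rewrite [RHS]exchange_big /=; apply: eq_bigr => y _.
    rewrite -mulr_sumr; congr (_ * _).
    rewrite /f (reindex_inj (mulIg y)) /=.
    by apply: eq_bigr => b _; rewrite mulgA mulgK.
  by apply: sumr_ge0 => b _; exact: (Apsd (fun x => h (b^-1 * x)%g)).
- by move=> c; apply: rpred_sum => b _; exact: (mxOverP Areal).
- rewrite -Atr /mxtrace (reindex _ (onW_bij _ (@enum_rank_bij gT))) /=.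
  by apply: eq_bigr => b _; rewrite mulg1.
- move=> x xX; apply: big1 => b _; apply: Aadj.
  by rewrite /= /cayley_adj mulKg.
- rewrite tE [in RHS]exchange_big [in LHS]exchange_big /=.
  by apply: eq_bigr => b _; rewrite (reindex_inj (mulgI b)).
Qed.

Lemma positive_type_values_sub_theta :
  positive_type_values R X `<=` theta_values R (Cay hX).
Proof.
move=> t [f [/positive_typeP fpsd freal f1 fX] tE].
have n_gt0 : 0 < #|gT|%:R :> R[i] by rewrite ltr0n; apply/card_gt0P; exists 1%g.
have n_neq0 := lt0r_neq0 n_gt0.
pose A : 'M[R[i]]_#|gT| :=
  \matrix_(i, j) (f ((enum_val j)^-1 * enum_val i)%g / #|gT|%:R).
have AE x y : A (enum_rank x) (enum_rank y) = f (y^-1 * x)%g / #|gT|%:R.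
  by rewrite mxE !enum_rankK.
exists A; [split|].
- apply/psdmxP => h; under eq_bigr do under eq_bigr do rewrite AE mulrA.
  under eq_bigr do rewrite -mulr_suml.
  by rewrite -mulr_suml divr_ge0 // ltW.
- by apply/mxOverP => i j; rewrite mxE rpred_div // realn.
- rewrite /mxtrace; under eq_bigr do rewrite mxE mulVg f1.
  by rewrite sumr_const card_ord -[LHS]mulr_natr mul1r mulVf.
- by move=> x y /= xy; rewrite AE fX // mul0r.
- rewrite tE exchange_big /=.
  have rowE (y : gT) :
      \sum_x A (enum_rank x) (enum_rank y) = (\sum_c f c) / #|gT|%:R.
    rewrite (reindex_inj (mulgI y)) /= mulr_suml.
    by apply: eq_bigr => x _; rewrite AE mulKg.
  rewrite (eq_bigr _ (fun y _ => rowE y)).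
  by rewrite sumr_const -[RHS]mulr_natr mulfVK.
Qed.

End Averaging.

(** * Existence of the maximum *)

Section Existence.
Variables (R : realType) (gT : finGroupType).

Definition linear_form (a : gT -> R) (r : 'rV[R]_#|gT|) : R :=
  \sum_c a c * r 0 (enum_rank c).

Lemma linear_form_continuous a : continuous (linear_form a).
Proof.
apply: continuous_big; first exact: add_continuous.
move=> c _ r; apply: (continuous_comp (@coord_continuous _ _ _ _ _ r)).
exact: mulrl_continuous.
Qed.

Lemma closed_linear_form_eq a b : closed [set r | linear_form a r = b].
Proof.
apply: (@closed_comp _ _ (linear_form a) [set z | z = b]).
  by move=> r _; exact: linear_form_continuous.
exact: closed_eq.
Qed.

Lemma closed_linear_form_ge a b : closed [set r | b <= linear_form a r].
Proof.
apply: (@closed_comp _ _ (linear_form a) [set z | b <= z]).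
  by move=> r _; exact: linear_form_continuous.
exact: closed_ge.
Qed.

(** Row vectors of reals serve as coordinates on real-valued functions, because
    they carry the topology in which boxes are compact. *)
Definition rowfun (r : 'rV[R]_#|gT|) (c : gT) : R[i] :=
  (r 0 (enum_rank c))%:C.

Lemma linear_form_delta c r :
  linear_form (fun d => (d == c)%:R) r = r 0 (enum_rank c).
Proof.
rewrite /linear_form (bigD1 c) //= eqxx mul1r big1 ?addr0 // => d /negbTE ->.
by rewrite mul0r.
Qed.

Lemma sum_rowfunE (w : gT -> R[i]) r :
  \sum_c w c * rowfun r c =
  (linear_form (fun c => complex.Re (w c)) r)
  +i* (linear_form (fun c => complex.Im (w c)) r).
Proof.
rewrite /linear_form /rowfun; elim/big_rec3: _ => // c x y z _ ->.
by case: (w c) => p q; rewrite /=; simpc.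
Qed.

(** A complex number is nonnegative when its imaginary part is zero and its
    real part is nonnegative; for each test function [g] these two parts are real
    linear forms in [r]. *)
Lemma closed_positive_type :
  closed [set r : 'rV[R]_#|gT| | positive_type (rowfun r)].
Proof.
rewrite (_ : [set r | _] = \bigcap_(g in [set: gT -> R[i]])
  ([set r | linear_form (fun c => complex.Im (conv g (invol g) c)) r = 0] `&`
   [set r | 0 <= linear_form (fun c => complex.Re (conv g (invol g) c)) r])).
  apply: closed_bigI => g _.
  apply: closedI; first exact: closed_linear_form_eq.
  exact: closed_linear_form_ge.
apply/seteqP; split=> [r rpos g _|r rpos g].
  by have := rpos g; rewrite sum_rowfunE lecE /= => /andP[/eqP].
rewrite sum_rowfunE lecE /=; have [/= -> ->] := rpos g I.
by rewrite eqxx.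
Qed.

Variable X : {set gT}.

Definition feasible : set 'rV[R]_#|gT| :=
  [set r | [/\ positive_type (rowfun r), r 0 (enum_rank 1%g) = 1 &
               forall x, x \in X -> r 0 (enum_rank x) = 0]].

Lemma positive_type_valuesE :
  positive_type_values R X = linear_form (fun=> 1) @` feasible.
Proof.
have sumE r : (linear_form (fun=> 1) r)%:C = \sum_c rowfun r c.
  by rewrite /linear_form rmorph_sum /=; apply: eq_bigr => c _; rewrite mul1r.
apply/seteqP; split=> [t [f [fpos freal f1 fX] tE]|_ [r [rpos r1 rX] <-]].
  pose r : 'rV[R]_#|gT| := \row_i complex.Re (f (enum_val i)).
  have rE : rowfun r = f.
    by apply/funext => c; rewrite /rowfun mxE enum_rankK RRe_real.
  exists r; last by apply: (@complexI R); rewrite sumE rE.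
  split; first by rewrite rE.
    by apply: (@complexI R); rewrite -[LHS]/(rowfun r 1%g) rE.
  by move=> x xX; apply: (@complexI R); rewrite -[LHS]/(rowfun r x) rE fX.
exists (rowfun r); last exact: sumE.
split=> //; first by move=> c; apply/complex_realP; exists (r 0 (enum_rank c)).
  by rewrite /rowfun r1.
by move=> x xX; rewrite /rowfun rX.
Qed.

(** [psd_kernel_bound] for the pair of the unit and [c] gives
    [-2 <= 2 f c <= 2], since the diagonal of the kernel is [f 1 = 1]. *)
Lemma compact_feasible : compact feasible.
Proof.
apply: (@subclosed_compact _ feasible
  [set r : 'rV[R]_#|gT| | forall i, `[-1, 1]%classic (r ord0 i)]).
- rewrite (_ : feasible = [set r | positive_type (rowfun r)] `&`
     [set r | linear_form (fun d => (d == 1%g)%:R) r = 1] `&`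
     \bigcap_(x in [set x | x \in X])
       [set r | linear_form (fun d => (d == x)%:R) r = 0]).
    apply: closedI; last first.
      by apply: closed_bigI => x _; exact: closed_linear_form_eq.
    apply: closedI; first exact: closed_positive_type.
    exact: closed_linear_form_eq.
  apply/seteqP; split=> r /=.
    move=> [rpos r1 rX]; split; first by rewrite linear_form_delta.
    by move=> x /= xX; rewrite linear_form_delta rX.
  move=> [[rpos]]; rewrite linear_form_delta => r1 rX; split=> // x xX.
  by rewrite -linear_form_delta; exact: rX.
- apply: (@rV_compact R _ (fun=> `[-1, 1]%classic)) => i.
  exact: segment_compact.
move=> r [/positive_typeP rpsd r1 _] i.
rewrite -(enum_valK i); set c := enum_val i.
have creal : rowfun r (1^-1 * c)%g \is Num.real.
  by apply/complex_realP; eexists.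
have := psd_kernel_bound rpsd creal.
rewrite !mulVg invg1 mul1g /rowfun r1 -rmorphD -rmorphN -rmorphMn /= !lecR.
rewrite in_itv /=; lra.
Qed.

(** Against the indicator function of the unit the positivity condition is
    about [conv g (invol g) 1], the squared l2 norm of [g]. *)
Lemma delta_feasible : 1%g \notin X ->
  feasible (delta_mx 0 (enum_rank 1%g)).
Proof.
move=> X1; have deltaE (c : gT) :
    delta_mx 0 (enum_rank 1%g) 0 (enum_rank c) = (c == 1%g)%:R :> R.
  by rewrite mxE eqxx (inj_eq enum_rank_inj).
split; last 2 first.
- by rewrite deltaE eqxx.
- by move=> x xX; rewrite deltaE; case: eqP xX X1 => // -> ->.
move=> g; rewrite (bigD1 1%g) //= big1 => [|c /negbTE c1]; last first.
  by rewrite /rowfun deltaE c1 mulr0.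
rewrite /rowfun deltaE eqxx mulr1 addr0; apply: sumr_ge0 => b _.
by rewrite /invol mulg1 invgK mul_conjC_ge0.
Qed.

End Existence.

Lemma is_maximum_maximum (R : realType) (S : set R) (t : R) :
  is_maximum S t -> is_maximum S (maximum S).
Proof. by move=> St; apply: (@xgetPex _ 0 (is_maximum S)); exists t. Qed.

Lemma positive_type_values_max (R : realType) (gT : finGroupType)
    (X : {set gT}) : 1%g \notin X ->
  exists t, is_maximum (positive_type_values R X) t.
Proof.
move=> X1; have [||/= r rX rmax] :=
  EVT_max_rV _ (@compact_feasible R gT X) (f := linear_form (fun=> 1)).
- by exists (delta_mx 0 (enum_rank 1%g)); exact: delta_feasible.
- exact: continuous_subspaceT (@linear_form_continuous _ _ _).
exists (linear_form (fun=> 1) r); rewrite positive_type_valuesE; split.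
  by exists r => //; rewrite inE in rX.
by move=> _ [s sX <-]; apply: rmax; rewrite inE.
Qed.

Theorem theorem2 (R : realType) (gT : finGroupType) (X : {set gT})
    (hX : connection_set X) :
  is_maximum (theta_values R (Cay hX)) (lovasz_theta R (Cay hX)) /\
  is_maximum (positive_type_values R X) (lovasz_theta R (Cay hX)).
Proof.
have valuesE : theta_values R (Cay hX) = positive_type_values R X.
  apply/seteqP; split; first exact: theta_values_sub_positive_type.
  exact: positive_type_values_sub_theta.
have [t tmax] := positive_type_values_max R (proj1 hX).
by have := is_maximum_maximum tmax; rewrite -valuesE.
Qed.
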